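(* Let $f\in\mathcal{S}(\mathbb{T}^n)$ be non-constant. Then the distribution function $d\lambda(s)=d\operatorname{vol}(\{x\in\mathbb{T}^n:f(x)>s\})$ is symmetric around $s=0$. In particular, $f$ satisfies sign equidistribution, that is, $\operatorname{vol}(\{x\in\mathbb{T}^n:f(x)>0\})=\operatorname{vol}(\{x\in\mathbb{T}^n:f(x)<0\})$, and its global extrema coincide in absolute value, that is, $\max_{\mathbb{T}^n} f=-\min_{\mathbb{T}^n} f$.
   Context: $\mathbb{T}^n=\mathbb{R}^n/\mathbb{Z}^n$ is the standard flat torus and $\operatorname{vol}$ is Lebesgue measure on it. $\mathcal{S}(\mathbb{T}^n)$ is the class of functions of the form $$f(x)=\sum_{i=1}^n\bigl(a_i\sin(2\pi\nu_i\cdot x)+b_i\cos(2\pi\nu_i\cdot x)\bigr),\qquad x\in\mathbb{T}^n,$$ where $a_i,b_i\in\mathbb{R}$ and $\nu_1,\dots,\nu_n\in\mathbb{Z}^n$ are linearly independent vectors. The distribution function $d\lambda$ is the Stieltjes measure of $s\mapsto\operatorname{vol}(\{f>s\})$; that it is symmetric around $s=0$ means that it is invariant under $s\mapsto -s$, i.e. $\operatorname{vol}(\{f>s\})=\operatorname{vol}(\{f<-s\})$ for every $s\in\mathbb{R}$. *)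

(* Defs.v *)
From HB Require Import structures.
From mathcomp Require Import all_boot all_order all_algebra generic_quotient.
From mathcomp Require Import all_classical all_reals all_analysis.

Set Implicit Arguments.
Unset Strict Implicit.
Unset Printing Implicit Defensive.

Import Order.TTheory GRing.Theory Num.Theory.
Import numFieldNormedType.Exports.

Local Open Scope classical_set_scope.
Local Open Scope ring_scope.
Local Open Scope quotient_scope.

(* R^n is [n.-tuple R], on which the library puts the product sigma-algebra;
   its Lebesgue measure is the n-fold product of [lebesgue_measure]. *)

Section lebesgue_tuple.
Context {R : realType}.

Definition tuple_cons n (z : measurableTypeR R * n.-tuple R) : n.+1.-tuple R :=
  [tuple of z.1 :: z.2].

Lemma measurable_tuple_cons n : measurable_fun setT (@tuple_cons n).
Proof. exact: measurable_cons. Qed.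

HB.instance Definition _ n := isMeasurableFun.Build _ _ _ _
  (@tuple_cons n) (@measurable_tuple_cons n).

Section lebesgue_cons.
Variables (n : nat) (mu : {sigma_finite_measure set (n.-tuple R) -> \bar R}).

Definition lebesgue_cons : set (n.+1.-tuple R) -> \bar R :=
  pushforward (lebesgue_measure \x mu)%E (@tuple_cons n).

Let lebesgue_cons0 : lebesgue_cons set0 = 0%E.
Proof. exact: measure0. Qed.

Let lebesgue_cons_ge0 A : (0 <= lebesgue_cons A)%E.
Proof. exact: measure_ge0. Qed.

Let lebesgue_cons_sigma_additive : semi_sigma_additive lebesgue_cons.
Proof. exact: measure_semi_sigma_additive. Qed.

HB.instance Definition _ := isMeasure.Build _ _ _ lebesgue_cons
  lebesgue_cons0 lebesgue_cons_ge0 lebesgue_cons_sigma_additive.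

Let lebesgue_cons_sigma_finite : sigma_finite setT lebesgue_cons.
Proof.
have /sigma_finiteP[F [TF ndF Foo]] := sigma_finiteT (@lebesgue_measure R).
have /sigma_finiteP[G [TG ndG Goo]] := sigma_finiteT mu.
pose g (t : n.+1.-tuple R) : measurableTypeR R * n.-tuple R :=
  (thead t, [tuple of behead t]).
have mg : measurable_fun setT g.
  apply/measurable_fun_pair; first exact: measurable_tnth.
  exact: measurable_behead.
have gK : cancel (@tuple_cons n) g.
  by case=> x t; congr pair; apply/val_inj.
exists (fun k => g @^-1` (F k `*` G k)) => [|k].
  rewrite -preimage_bigcup (_ : \bigcup_k _ = setT) ?preimage_setT//.
  apply/seteqP; split=> // -[x y] _.
  have [k _ Fkx] : (\bigcup_k F k) x by rewrite -TF.
  have [l _ Gly] : (\bigcup_k G k) y by rewrite -TG.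
  exists (maxn k l) => //; split.
  - by move: x Fkx; exact/subsetPset/ndF/leq_maxl.
  - by move: y Gly; exact/subsetPset/ndG/leq_maxr.
have [[mFk Fk] [mGk Gk]] := (Foo k, Goo k).
split.
  by rewrite -[X in measurable X]setTI; apply: mg => //; exact: measurableX.
rewrite /lebesgue_cons /pushforward -comp_preimage.
rewrite (_ : g \o _ = id) ?preimage_id; last by apply/funext => z /=; rewrite gK.
by rewrite product_measure1E// lte_mul_pinfty// ge0_fin_numE.
Qed.

HB.instance Definition _ := Measure_isSigmaFinite.Build _ _ _ lebesgue_cons
  lebesgue_cons_sigma_finite.

End lebesgue_cons.

Fixpoint lebesgue_tuple (n : nat) :
    {sigma_finite_measure set (n.-tuple R) -> \bar R} :=
  match n with
  | 0 => \d_[tuple]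
  | n'.+1 => lebesgue_cons (lebesgue_tuple n')
  end.

End lebesgue_tuple.

Section torus.
Variables (R : realType) (n : nat).

Definition torus_rel : rel (n.-tuple R) :=
  fun x y => [forall i, tnth x i - tnth y i \is a Num.int].

Let torus_rel_refl : reflexive torus_rel.
Proof. by move=> x; apply/forallP => i; rewrite subrr rpred0. Qed.

Let torus_rel_sym : symmetric torus_rel.
Proof.
by move=> x y; apply: eq_forallb => i; rewrite -opprB rpredN.
Qed.

Let torus_rel_trans : transitive torus_rel.
Proof.
move=> y x z /forallP xy /forallP yz; apply/forallP => i.
by rewrite -(subrK (tnth y i) (tnth x i)) -addrA rpredD.
Qed.

Canonical torus_equiv :=
  EquivRel torus_rel torus_rel_refl torus_rel_sym torus_rel_trans.

Definition torus : Type := {eq_quot torus_rel}.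

HB.instance Definition _ := Choice.on torus.
HB.instance Definition _ := EqQuotient.on torus.

Definition torus_pi (x : n.-tuple R) : torus := \pi_torus x.

Definition torus_measurable : set (set torus) :=
  [set A | measurable (torus_pi @^-1` A)].

Let torus_measurable0 : torus_measurable set0.
Proof. by rewrite /torus_measurable/= preimage_set0. Qed.

Let torus_measurableC A : torus_measurable A -> torus_measurable (~` A).
Proof. by rewrite /torus_measurable/= preimage_setC; exact: measurableC. Qed.

Let torus_measurable_bigcup (F : (set torus)^nat) :
  (forall i, torus_measurable (F i)) -> torus_measurable (\bigcup_i F i).
Proof.
move=> mF; rewrite /torus_measurable/= preimage_bigcup.
by apply: bigcup_measurable => i _; exact: mF.
Qed.

HB.instance Definition _ := isPointed.Build torus (torus_pi [tuple 0 | i < n]).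

HB.instance Definition _ := @isMeasurable.Build default_measure_display torus
  torus_measurable torus_measurable0 torus_measurableC torus_measurable_bigcup.

Lemma measurable_torus_pi : measurable_fun setT torus_pi.
Proof. by move=> _ A mA; rewrite setTI. Qed.

HB.instance Definition _ := isMeasurableFun.Build _ _ _ _
  torus_pi measurable_torus_pi.

Definition unit_cube : set (n.-tuple R) :=
  [set x | forall i, 0 <= tnth x i < 1].

Lemma measurable_unit_cube : measurable unit_cube.
Proof.
rewrite (_ : unit_cube =
    \bigcap_(i in [set: 'I_n]) ((@tnth _ R ^~ i) @^-1` `[0, 1[)).
  apply: fin_bigcap_measurable => [//|i _].
  by rewrite -[X in measurable X]setTI; apply: measurable_tnth.
apply/seteqP; split=> x /= cx i; first by rewrite /= in_itv/=.
by have := cx i Logic.I; rewrite /= in_itv/=.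
Qed.

Definition vol : set torus -> \bar R :=
  pushforward (mrestr (lebesgue_tuple n) measurable_unit_cube) torus_pi.

Let vol0 : vol set0 = 0%E.
Proof. exact: measure0. Qed.

Let vol_ge0 A : (0 <= vol A)%E.
Proof. exact: measure_ge0. Qed.

Let vol_sigma_additive : semi_sigma_additive vol.
Proof. exact: measure_semi_sigma_additive. Qed.

HB.instance Definition _ := isMeasure.Build _ _ _ vol
  vol0 vol_ge0 vol_sigma_additive.

Definition dot_int (nu : 'rV[int]_n) (x : n.-tuple R) : R :=
  \sum_(j < n) (nu 0 j)%:~R * tnth x j.

Definition sine_sum (f : torus -> R) : Prop :=
  exists (a b : 'I_n -> R) (nu : 'I_n -> 'rV[int]_n),
    row_free (\matrix_(i, j) (nu i 0 j)%:~R : 'M[R]_n) /\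
    forall x : n.-tuple R, f (torus_pi x) =
      \sum_(i < n) (a i * sin (2 * pi * dot_int (nu i) x) +
                    b i * cos (2 * pi * dot_int (nu i) x)).

(* [s |-> vol {f > s}] is nonincreasing, so the library's Stieltjes measure
   applies to its opposite; this only changes the sign of the measure. *)
Definition symmetric_distribution (f : torus -> R) : Prop :=
  exists F : cumulative R R,
    (forall s, (F s)%:E = - vol [set x | s < f x]%R)%E /\
    forall B : set R, measurable B ->
      lebesgue_stieltjes_measure F (-%R @^-1` B) =
      lebesgue_stieltjes_measure F B.

End torus.

(* Main.v *)
Require Import Defs.
From HB Require Import structures.
From mathcomp Require Import all_boot all_order all_algebra generic_quotient.
From mathcomp Require Import all_classical all_reals all_analysis.
From mathcomp Require Import measurable_realfun ring lra.

Import Order.TTheory GRing.Theory Num.Theory.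
Import numFieldNormedType.Exports.
Local Open Scope classical_set_scope.
Local Open Scope ring_scope.

(** The linear independence of the frequencies [nu i] makes the system
    [nu i . v = 1/2] solvable for a vector [v] ([half_period]).  Translating by
    [v] shifts every argument [2 pi (nu i . x)] by [pi], so it changes the sign
    of every sine and cosine: [f (x + v) = - f x] ([sine_sum_antiperiodic]).

    Translations of the torus preserve [vol] ([vol_translation]), so [f] and
    [- f] have the same distribution.  This gives [vol {f > s} = vol {f < - s}]
    for all [s], and at [s = 0] sign equidistribution.  The Stieltjes measure of
    [s |-> - vol {f > s}] is the distribution of [f] ([stieltjes_ccdf]), so it
    is invariant under [s |-> - s].  Finally [f] attains a maximum by
    compactness ([sine_sum_max]), and its translate by [v] is a point where [f]
    is minimal, with the opposite value.

    The volume being defined through the fundamental cell [[0, 1[^n], its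
    invariance under translations is proved as an identity between volumes of
    the traces on the cell of a periodic set and of its translate
    ([lebesgue_tuple_translation]), by induction on the dimension: slicing
    along the first coordinate reduces it to the invariance under translation
    of the integral over [[0, 1[] of a [1]-periodic function
    ([ge0_integral_periodic]). *)

Local Notation cube := (@unit_cube _ _).

(** * Integrals of periodic functions of one variable *)

Section translation.
Variable R : realType.
Local Notation mu := (@lebesgue_measure R).

(** The translation [x |-> x + a] of the real line, on the type that carries
    [lebesgue_measure]. *)
Definition translation (a : R) : measurableTypeR R -> measurableTypeR R :=
  fun x => (x : R) + a.

Lemma measurable_translation a : measurable_fun setT (translation a).
Proof.
move=> mT B mB.
apply: (@measurable_funD _ (measurableTypeR R) R setT idfun (cst a)
  _ _ mT B mB).
  exact: (@measurable_id _ (measurableTypeR R) setT).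
exact: measurable_cst.
Qed.

Lemma lebesgue_measure_translation (a : R) (A : set R) : measurable A ->
  pushforward mu (translation a) A = mu A.
Proof.
move=> mA; apply/esym/lebesgue_measure_unique => //.
  exact: measurable_translation.
move=> mT _ [[l r]] _ <-.
transitivity (mu `]l - a, r - a]%classic).
  rewrite !lebesgue_measure_itv/= !lte_fin ltrD2r; case: ifPn => // _.
  by rewrite -!EFinD; congr (_%:E); ring.
by congr (mu _); apply/seteqP; split=> x /=;
  rewrite /translation !in_itv/= ltrBlDr lerBrDr.
Qed.

Lemma ge0_integral_translation (a : R) (D : set R) (g : R -> \bar R) :
  measurable D -> measurable_fun D g -> (forall x, 0 <= g x)%E ->
  (\int[mu]_(x in (fun x : R => (x + a)%R) @^-1` D) g (x + a)%R =
   \int[mu]_(x in D) g x)%E.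
Proof.
move=> mD mg g0.
rewrite -(@ge0_integral_pushforward _ _ _ _ _ _
  (measurable_translation a) mu D g)//.
apply: eq_measure_integral => [|mT A mA _]; first exact: measurable_translation.
exact: lebesgue_measure_translation.
Qed.

(** With [b] the fractional part of [a], the integral over [[b, 1 + b[] is cut
    at [1], and the piece over [[1, 1 + b[] is moved back to [[0, b[]. *)
Lemma ge0_integral_periodic (a : R) (g : R -> \bar R) :
  measurable_fun setT g -> (forall x, 0 <= g x)%E ->
  (forall x (k : int), g (x + k%:~R)%R = g x) ->
  (\int[mu]_(x in `[0%R, 1%R[) g (x + a)%R = \int[mu]_(x in `[0%R, 1%R[) g x)%E.
Proof.
move=> mg g0 gper.
pose b : R := a - (Num.floor a)%:~R.
have b0 : 0 <= b by rewrite subr_ge0 ge_floor.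
have b1 : b < 1 by rewrite /b; have := floorD1_gt a; rewrite intrD; lra.
have -> : (\int[mu]_(x in `[0%R, 1%R[) g (x + a)%R =
           \int[mu]_(x in `[0%R, 1%R[) g (x + b)%R)%E.
  apply: eq_integral => x _.
  by rewrite -(gper (x + b) (Num.floor a)) /b -addrA subrK.
have mD (D : set R) : measurable_fun D g by exact: measurable_funTS.
have itvE (c l r : R) :
    (fun x => x + c) @^-1` `[l, r[ = `[l - c, r - c[%classic.
  by apply/seteqP; split=> x /=; rewrite !in_itv/= lerBlDr ltrBrDr.
have -> : (\int[mu]_(x in `[0%R, 1%R[) g (x + b)%R =
           \int[mu]_(x in `[b, (1 + b)%R[) g x)%E.
  by rewrite -(ge0_integral_translation b `[b, 1 + b[)// itvE subrr addrK.
have splt (l m r : R) : l <= m -> m <= r ->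
    (\int[mu]_(x in `[l, r[) g x =
     \int[mu]_(x in `[l, m[) g x + \int[mu]_(x in `[m, r[) g x)%E.
  move=> lm mr; rewrite -ge0_integral_setU//=.
  - by rewrite -itv_bndbnd_setU// bnd_simp.
  - exact: mD.
  - apply/disj_setPS => x [] /=; rewrite !in_itv/= => /andP[_ xm] /andP[mx _].
    by rewrite ltNge mx in xm.
rewrite (splt b 1 (1 + b)) ?lerDl// 1?ltW// [RHS](splt 0 b 1)// 1?ltW//.
rewrite addeC; congr (_ + _)%E.
rewrite -(ge0_integral_translation 1 `[1, 1 + b[)// itvE subrr addrAC subrr.
rewrite add0r.
by apply: eq_integral => x _; rewrite -(gper x 1).
Qed.

End translation.

(** * Slicing along the first coordinate *)

(** The translation of [R^n] by [v]. *)
Definition tuple_translation {R : realType} {n : nat} (v x : n.-tuple R)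
    : n.-tuple R :=
  [tuple tnth x i + tnth v i | i < n].

Section cons.
Context {R : realType} {n : nat}.

Lemma tuple_translation_cons (a x : R) (v t : n.-tuple R) :
  tuple_translation (tuple_cons (a, v)) (tuple_cons (x, t)) =
  tuple_cons (x + a, tuple_translation v t).
Proof.
apply: eq_from_tnth => i; rewrite tnth_mktuple /=.
by case: (unliftP ord0 i) => [j ->|->]; rewrite ?tnthS ?tnth_mktuple.
Qed.

Lemma unit_cube_cons (x : R) (t : n.-tuple R) :
  unit_cube (tuple_cons (x, t)) <-> 0 <= x < 1 /\ unit_cube t.
Proof.
split=> [cxt|[x01 ct] i].
  by split=> [|j]; [exact: (cxt ord0)|have := cxt (lift ord0 j); rewrite tnthS].
by case: (unliftP ord0 i) => [j ->|->//]; rewrite tnthS; exact: ct.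
Qed.

(** Cavalieri's principle for the first coordinate. *)
Lemma lebesgue_tuple_consE (A : set (n.+1.-tuple R)) :
  lebesgue_tuple n.+1 A =
  (\int[lebesgue_measure]_x lebesgue_tuple n [set t | A (tuple_cons (x, t))])%E.
Proof.
apply: eq_integral => x _; congr (lebesgue_tuple n _).
by apply/seteqP; split=> t; rewrite /xsection /= ?inE.
Qed.

Lemma measurable_lebesgue_tuple_section (A : set (n.+1.-tuple R)) :
  measurable A ->
  measurable_fun [set: R]
    (fun x => lebesgue_tuple n [set t | A (tuple_cons (x, t))]).
Proof.
move=> mA.
have mB : measurable (@tuple_cons R n @^-1` A).
  by rewrite -[X in measurable X]setTI; apply: measurable_tuple_cons.
have := @measurable_fun_xsection _ _ _ _ R (lebesgue_tuple n) _ mB.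
congr (measurable_fun _ _); apply/funext => x /=; congr (lebesgue_tuple n _).
by apply/seteqP; split=> t; rewrite /xsection /= ?inE.
Qed.

End cons.

(** * Translations of periodic sets *)

Section torus.
Context {R : realType}.

Lemma torus_rel_tuple_cons {n} (x y : R) (s t : n.-tuple R) :
  x - y \is a Num.int -> torus_rel s t ->
  torus_rel (tuple_cons (x, s)) (tuple_cons (y, t)).
Proof.
move=> xy /forallP st; apply/forallP => i.
by case: (unliftP ord0 i) => [j ->|->//]; rewrite !tnthS.
Qed.

Lemma measurable_tuple_cons_section {n} (x : R) (A : set (n.+1.-tuple R)) :
  measurable A -> measurable [set t | A (tuple_cons (x, t))].
Proof.
move=> mA; rewrite -[X in measurable X]setTI.
suff : measurable_fun setT (fun t : n.-tuple R => tuple_cons (x, t)) by exact.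
exact: (measurable_cons (measurable_cst x) (@measurable_id _ _ setT)).
Qed.

(** The part of a [Z^n]-periodic set in the unit cube and that of its translate
    have the same volume. *)
Lemma lebesgue_tuple_translation {n} (v : n.-tuple R) (P : set (n.-tuple R)) :
  measurable P -> (forall x y, torus_rel x y -> P x -> P y) ->
  lebesgue_tuple n (tuple_translation v @^-1` P `&` cube) =
  lebesgue_tuple n (P `&` cube).
Proof.
elim: n => [|n IHn] in v P * => mP perP.
  congr (lebesgue_tuple 0 (_ `&` _)); apply/seteqP.
  by split=> x; rewrite /preimage/= (tuple0 (tuple_translation v x)) (tuple0 x).
case/tupleP: v => a v.
pose Q (x : R) : set (n.-tuple R) := [set t | P (tuple_cons (x, t))].
have mQ x : measurable (Q x) by exact: measurable_tuple_cons_section.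
have perQ x s t : torus_rel s t -> Q x s -> Q x t.
  by move=> st; apply/perP/torus_rel_tuple_cons => //; rewrite subrr rpred0.
pose g (x : R) := lebesgue_tuple n (Q x `&` cube).
have mg : measurable_fun setT g.
  pose B := P `&` (fun x : n.+1.-tuple R => [tuple of behead x]) @^-1` cube.
  have mB : measurable B.
    apply: measurableI => //; rewrite -[X in measurable X]setTI.
    by apply: measurable_behead => //; exact: measurable_unit_cube.
  have := measurable_lebesgue_tuple_section _ mB.
  congr (measurable_fun _ _); apply/funext => x.
  congr (lebesgue_tuple n _); apply/seteqP; split=> t [Pxt ct]; split=> //;
    by move: ct; congr (cube _); exact: val_inj.
(* The induction hypothesis removes the translation from the slices, so only
   the translation of the first coordinate remains. *)
have integrandE (b : R) (w : n.-tuple R) :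
    lebesgue_tuple n.+1 (tuple_translation (tuple_cons (b, w)) @^-1` P
      `&` cube) =
    (\int[lebesgue_measure]_(x in `[0%R, 1%R[) g (x + b)%R)%E.
  rewrite lebesgue_tuple_consE [RHS]integral_mkcond; apply: eq_integral => x _.
  rewrite patchE; case: ifPn => [/set_mem|/negP x01].
    rewrite /= in_itv/= => x01.
    rewrite /g -(IHn w (Q (x + b)))//; last exact: perQ.
    congr (lebesgue_tuple n _); apply/seteqP; split=> t [].
      by rewrite /= tuple_translation_cons => ? /unit_cube_cons[].
    move=> Qt ct; split; first by rewrite /= tuple_translation_cons.
    exact/unit_cube_cons.
  transitivity (@lebesgue_tuple R n set0); last exact: measure0.
  congr (lebesgue_tuple n _).
  apply/seteqP; split=> t // [_ /unit_cube_cons[c _]].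
  by apply/x01/mem_set; rewrite /= in_itv.
rewrite integrandE.
transitivity (\int[lebesgue_measure]_(x in `[0%R, 1%R[) g (x + 0)%R)%E.
  under [RHS]eq_integral do rewrite addr0.
  apply: ge0_integral_periodic => // x k.
  have QE y y' : y - y' \is a Num.int -> Q y `<=` Q y'.
    by move=> yy' t; exact/perP/torus_rel_tuple_cons.
  rewrite /g; congr (lebesgue_tuple n (_ `&` _)).
  apply/seteqP; split; apply: QE.
    by rewrite addrC addrA addNr add0r intr_int.
  by rewrite opprD addrA subrr sub0r rpredN intr_int.
(* The untranslated side is [integrandE] for the translation by zero. *)
pose z : n.+1.-tuple R := tuple_cons (0, [tuple 0 | i < n]).
have zE x : tuple_translation z x = x.
  apply: eq_from_tnth => i; rewrite tnth_mktuple.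
  by case: (unliftP ord0 i) => [j ->|->]; rewrite /z ?tnthS ?tnth_mktuple addr0.
have -> : P = tuple_translation z @^-1` P.
  by apply/seteqP; split=> x; rewrite /preimage /mkset zE.
exact/esym/integrandE.
Qed.

End torus.

(** * The torus as a probability space *)

Section torus_vol.
Context {R : realType} {n : nat}.
Implicit Types (A B : set (torus R n)) (x y v : n.-tuple R).

Lemma torus_piP x y : torus_rel x y -> torus_pi x = torus_pi y.
Proof. by move=> xy; apply/eqquotP. Qed.

Lemma torus_pi_surj (p : torus R n) : exists x, p = torus_pi x.
Proof. by exists (repr p); rewrite /torus_pi reprK. Qed.

(** [vol] is invariant under translations. The hypothesis says that [B] is the
    preimage of [A] by the translation by [v], in terms of representatives. *)
Lemma vol_translation v A B : measurable A ->
  (forall x, B (torus_pi x) <-> A (torus_pi (tuple_translation v x))) ->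
  vol B = vol A.
Proof.
move=> mA BA; rewrite /vol /pushforward /mrestr.
rewrite -[RHS](lebesgue_tuple_translation v)//; last first.
  by move=> x y xy; rewrite /preimage/= (torus_piP _ _ xy).
congr (lebesgue_tuple n (_ `&` _)).
by apply/seteqP; split=> x /BA.
Qed.

End torus_vol.

Lemma lebesgue_tuple_unit_cube (R : realType) n :
  lebesgue_tuple n (@unit_cube R n) = 1%E.
Proof.
elim: n => [|n IHn]; first by rewrite /= diracE mem_set// => -[].
rewrite lebesgue_tuple_consE.
transitivity (\int[lebesgue_measure]_(x in `[0%R, 1%R[%classic : set R) 1)%E.
  rewrite [RHS]integral_mkcond; apply: eq_integral => x _.
  rewrite patchE; case: ifPn => [/set_mem|/negP x01].
    rewrite /= in_itv/= => x01; rewrite -IHn; congr (lebesgue_tuple n _).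
    by apply/seteqP; split=> t; rewrite /mkset unit_cube_cons => // -[].
  transitivity (@lebesgue_tuple R n set0); last exact: measure0.
  congr (lebesgue_tuple n _); apply/seteqP; split=> t // /unit_cube_cons[c _].
  by apply/x01/mem_set; rewrite /= in_itv.
rewrite integral_cst//= lebesgue_measure_itv/= lte_fin ltr01 mul1e.
by rewrite oppr0 adde0.
Qed.

Lemma vol_setT (R : realType) n : vol [set: torus R n] = 1%E.
Proof.
rewrite /vol /pushforward /mrestr preimage_setT setTI.
exact: lebesgue_tuple_unit_cube.
Qed.

HB.instance Definition _ (R : realType) n :=
  Measure_isProbability.Build _ _ _ (@vol R n) (vol_setT R n).

(** * The Stieltjes measure of a complementary distribution function *)

Section stieltjes_ccdf.
Context d (T : measurableType d) (R : realType) (P : probability T R).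
Variable X : {RV P >-> R}.

Let F (s : R) : R := - fine (ccdf X s).

Let F_nd : nondecreasing F.
Proof.
move=> s t st; rewrite lerN2 fine_le ?fin_num_measure//.
exact: ccdf_nonincreasing.
Qed.

Let F_rc : right_continuous F.
Proof.
move=> s; apply: cvgN; apply: fine_cvg.
by rewrite fineK ?fin_num_measure//; exact: ccdf_right_continuous.
Qed.

#[local] HB.instance Definition _ := isCumulative.Build R _ R F F_nd F_rc.

(** The opposite of the complementary distribution function of a random
    variable is cumulative, and its Stieltjes measure is the distribution. *)
Lemma stieltjes_ccdf : exists G : cumulative R R,
  (forall s, (G s)%:E = - ccdf X s)%E /\
  forall B : set R, measurable B ->
    lebesgue_stieltjes_measure G B = distribution P X B.
Proof.
exists F; split=> [s|B mB]; first by rewrite EFinN fineK// fin_num_measure.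
(* [measurableTypeR R] and [R] have the same measurable sets, but their
   displays differ. *)
have mX : measurable_fun setT (X : T -> measurableTypeR R).
  by move=> mT Y mY; exact: (@measurable_funPT _ _ _ _ X mT Y mY).
have := @lebesgue_stieltjes_measure_unique R F
  (pushforward P (X : T -> measurableTypeR R)).
move=> /(_ mX) H; apply: H mB => _ [[a b]] /= _ <-.
rewrite /lebesgue_stieltjes_measure /measure_extension/=.
rewrite measurable_mu_extE/=; last exact: is_ocitv.
have [ab|ba] := leP a b; last first.
  by rewrite set_itv_ge ?wlength0 ?measure0// bnd_simp -leNgt ltW.
rewrite wlength_itv_bnd// /F opprK addrC EFinB !fineK ?fin_num_measure//.
rewrite -[RHS]/(distribution P X `]a, b]) /ccdf.
have -> : `]a, b]%classic = `]a, +oo[ `\` `]b, +oo[.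
  rewrite setDE setCitvr; apply/seteqP; split=> y /=; rewrite !in_itv/= andbT.
    by move=> /andP[].
  by move=> [-> ->].
rewrite measureD ?setIidr//=; first by apply: subset_itvr.
by rewrite -ge0_fin_numE// fin_num_measure.
Qed.

End stieltjes_ccdf.

(** * Sine sums *)

Section sine_sum.
Context {R : realType} {n : nat}.
Implicit Types (nu : 'I_n -> 'rV[int]_n) (x v : n.-tuple R).

Lemma dot_intD (m : 'rV[int]_n) v x :
  dot_int m (tuple_translation v x) = dot_int m x + dot_int m v.
Proof.
by rewrite -big_split; apply: eq_bigr => j _; rewrite tnth_mktuple mulrDr.
Qed.

(** Linearly independent frequencies, seen as linear forms, take the value [1/2]
    at a common vector. *)
Lemma half_period nu :
  row_free (\matrix_(i, j) (nu i 0 j)%:~R : 'M[R]_n) ->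
  exists v : n.-tuple R, forall i, dot_int (nu i) v = 2^-1.
Proof.
set N := \matrix_(i, j) _.
rewrite row_free_unit => uN.
pose w : 'cV[R]_n := invmx N *m const_mx 2^-1.
exists [tuple w j 0 | j < n] => i.
have := mulKVmx uN (const_mx 2^-1 : 'cV[R]_n); rewrite -/w.
move=> /matrixP/(_ i 0); rewrite !mxE => <-.
by apply: eq_bigr => j _; rewrite tnth_mktuple !mxE.
Qed.

Lemma sine_sum_antiperiodic (f : torus R n -> R) : sine_sum f ->
  exists v, forall x, f (torus_pi (tuple_translation v x)) = - f (torus_pi x).
Proof.
move=> [a] [b] [nu] [/half_period[v vE] fE]; exists v => x.
rewrite !fE -sumrN; apply: eq_bigr => i _; rewrite dot_intD vE.
have -> : 2 * pi * (dot_int (nu i) x + 2^-1) = 2 * pi * dot_int (nu i) x + pi.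
  by field.
by rewrite sinDpi cosDpi !mulrN opprD.
Qed.

Lemma measurable_sine_sum (f : torus R n -> R) :
  sine_sum f -> measurable_fun setT f.
Proof.
move=> [a] [b] [nu] [_ fE].
suff mg : measurable_fun setT (f \o @torus_pi R n).
  by move=> _ B mB; have := mg measurableT B mB; rewrite !setTI.
rewrite (_ : f \o _ = fun x =>
    \sum_(i < n) (a i * sin (2 * pi * dot_int (nu i) x) +
                  b i * cos (2 * pi * dot_int (nu i) x))); last first.
  by apply/funext => x /=; rewrite fE.
have md (m : 'rV[int]_n) : measurable_fun setT (fun x => 2 * pi * dot_int m x).
  apply: measurable_funM => //; apply: measurable_sum => j.
  by apply: measurable_funM => //; exact: measurable_tnth.
apply: measurable_sum => i.
apply: measurable_funD; apply: measurable_funM => //.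
- apply: measurableT_comp (md _); apply: continuous_measurable_fun.
  exact: continuous_sin.
- apply: measurableT_comp (md _); apply: continuous_measurable_fun.
  exact: continuous_cos.
Qed.

(** The lift of [f] to row vectors is continuous, and every point of the torus
    has a representative in the compact cube [[0, 1]^n]. *)
Lemma sine_sum_max (f : torus R n -> R) :
  sine_sum f -> exists p, forall q, f q <= f p.
Proof.
move=> [a] [b] [nu] [_ fE].
pose t (w : 'rV[R]_n) := [tuple w 0 i | i < n].
have cM (c : R) (h : 'rV[R]_n -> R) :
    continuous h -> continuous (fun w => c * h w).
  by move=> ch w; exact: (continuous_comp (ch w) (@mulrl_continuous R c _)).
have cD (g h : 'rV[R]_n -> R) : continuous g -> continuous h ->
    continuous (fun w => g w + h w).
  by move=> cg ch w; exact: (continuousD (cg w) (ch w)).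
have cS (h : 'I_n -> 'rV[R]_n -> R) : (forall i, continuous (h i)) ->
    continuous (fun w => \sum_(i < n) h i w).
  move=> ch; apply: (@continuous_big R^o 'I_n +%R 0 xpredT) => //.
  exact: add_continuous.
have cg : continuous (fun w => f (torus_pi (t w))).
  have cd (m : 'rV[int]_n) : continuous (fun w => 2 * pi * dot_int m (t w)).
    apply: (cM); apply: (cS) => j; apply: (cM).
    under eq_fun do rewrite tnth_mktuple.
    exact: coord_continuous.
  under eq_fun do rewrite fE.
  apply: (cS) => i; apply: (cD); apply: (cM) => w.
  - exact: (continuous_comp (cd _ w) (@continuous_sin R _)).
  - exact: (continuous_comp (cd _ w) (@continuous_cos R _)).
pose K := [set w : 'rV[R]_n | forall i, `[0%R, 1%R]%classic (w ord0 i)].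
have K0 : K !=set0.
  by exists 0 => i; rewrite /= mxE in_itv/= lexx ler01.
have cK : compact K.
  apply: (@rV_compact R n (fun=> `[0, 1]%classic)) => i.
  exact: segment_compact.
have [c _ cmax] := compact_EVT_max K0 cK (continuous_subspaceT cg).
exists (torus_pi (t c)) => q; have [x ->] := torus_pi_surj q.
pose y : 'rV[R]_n := \row_i (tnth x i - (Num.floor (tnth x i))%:~R).
have -> : torus_pi x = torus_pi (t y).
  apply: torus_piP; apply/forallP => i.
  by rewrite tnth_mktuple mxE opprB addrC subrK intr_int.
apply: cmax; rewrite inE => i; rewrite /= mxE in_itv/= subr_ge0 ge_floor/=.
have := floorD1_gt (tnth x i); rewrite intrD; lra.
Qed.

End sine_sum.

Theorem theorem2p5 (R : realType) (n : nat) (f : torus R n -> R)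
    (f_sine : sine_sum f) (f_nonconst : ~ exists c : R, forall x, f x = c) :
  [/\ symmetric_distribution f,
      forall s : R, vol [set x | f x > s] = vol [set x | f x < - s],
      vol [set x | f x > 0] = vol [set x | f x < 0] &
      exists M m : R, [/\ range f M /\ ubound (range f) M,
                          range f m /\ lbound (range f) m &
                          M = - m]].
Proof.
have [v fv] := sine_sum_antiperiodic _ f_sine.
have mf := measurable_sine_sum _ f_sine.
have symP (B : set R) : measurable B ->
    vol (f @^-1` (-%R @^-1` B)) = vol (f @^-1` B).
  move=> mB; apply: (vol_translation v).
    by rewrite -[X in measurable X]setTI; apply: mf.
  by move=> x; rewrite /preimage/= fv.
have symvol (s : R) : vol [set x | f x > s] = vol [set x | f x < - s].
  rewrite (_ : [set x | f x > s] = f @^-1` (-%R @^-1` `]-oo, - s[)).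
    by rewrite symP.
  by apply/seteqP; split=> x; rewrite /preimage/= in_itv/= ltrN2.
split => //.
- pose fm : {mfun torus R n >-> R} :=
    HB.pack f (isMeasurableFun.Build _ _ _ _ f mf).
  have [F [FE FP]] := @stieltjes_ccdf _ _ _ (@vol R n) fm.
  exists F; split=> [s|B mB].
    rewrite FE; congr (- vol _)%E; apply/seteqP.
    by split=> x; rewrite /preimage/= in_itv/= andbT.
  have mNB : measurable (-%R @^-1` B).
    by rewrite -[X in measurable X]setTI; exact: oppr_measurable.
  by rewrite !FP//; exact: symP.
- by rewrite symvol oppr0.
- have [p fp] := sine_sum_max _ f_sine; have [x pE] := torus_pi_surj p.
  have fpv : f (torus_pi (tuple_translation v x)) = - f p by rewrite fv pE.
  exists (f p), (- f p); rewrite opprK; split=> //; split.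
  + by exists p.
  + by move=> _ [q _ <-].
  + by exists (torus_pi (tuple_translation v x)).
  + move=> _ [q _ <-]; have [y ->] := torus_pi_surj q.
    by rewrite lerNl -fv.
Qed.
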